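(* Let $0<q<1$, $N\ge1$ an integer, $\mathcal X=\{0,1,\dots,N\}$, $0<a<1$, $0<b<1$, $c<1$, and let $$K(x,y)=\sum_{z=0}^{\min(x,y)}\pi(x-z,N-z,b,c)\,\pi(z,y,a,b)\qquad(x,y\in\mathcal X),$$ where $\pi$ is the $q$-Hahn measure. Then $K(x,y)\ge0$, $\sum_{x\in\mathcal X}K(x,y)=1$, the symmetry condition $$K(x,y)\,\pi(y,N,ab,c)=K(y,x)\,\pi(x,N,ab,c)\qquad(x,y\in\mathcal X)$$ holds, and for all $n,x\in\mathcal X$ $$\sum_{y\in\mathcal X}K(x,y)\,\pi(y,N,ab,c)\,\check P_n(y,ab,c)=\kappa(n)\,\pi(x,N,ab,c)\,\check P_n(x,ab,c),$$ with $$\kappa(n)=\sum_{k=0}^{n}\frac{(q^{-n};q)_k(abcq^{n-1};q)_k(b;q)_k}{(ab;q)_k(bc;q)_k(q;q)_k}q^k=\frac{b^n(a;q)_n(c;q)_n}{(ab;q)_n(bc;q)_n}.$$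
   Context: $(a;q)_n=\prod_{i=0}^{n-1}(1-aq^i)$. The $q$-Hahn measure with parameters $0<a<1$, $b<1$ is, for integers $0\le x\le M$, $\pi(x,M,a,b)=\frac{(q;q)_M}{(q;q)_x(q;q)_{M-x}}\frac{(a;q)_x(b;q)_{M-x}a^{M-x}}{(ab;q)_M}$. The $q$-Hahn polynomials on $\mathcal X$ are $\check P_n(x,a,b)=\sum_{k=0}^n\frac{(q^{-n};q)_k(abq^{n-1};q)_k(q^{-x};q)_k}{(a;q)_k(q^{-N};q)_k(q;q)_k}q^k$. *)

(* Defs.v *)
From mathcomp Require Import all_boot all_order all_algebra.

Set Implicit Arguments.
Unset Strict Implicit.
Unset Printing Implicit Defensive.

Import Order.TTheory GRing.Theory Num.Theory.
Local Open Scope ring_scope.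

(* (a; q)_n *)
Definition qpoch (R : realFieldType) (q a : R) (n : nat) : R :=
  \prod_(i < n) (1 - a * q ^+ i).

(* Meaningful only for x <= M, since the subtraction M - x is truncated. *)
Definition qhahn_pi (R : realFieldType) (q : R) (x M : nat) (a b : R) : R :=
  qpoch q q M / (qpoch q q x * qpoch q q (M - x))
  * (qpoch q a x * qpoch q b (M - x) * a ^+ (M - x) / qpoch q (a * b) M).

(* Meaningful only for n, x <= N: for N < k the denominator (q^-N; q)_k is 0.
   The exponent n - 1 is an integer one, so that it is -1 for n = 0. *)
Definition qhahn_poly (R : realFieldType) (q : R) (N n x : nat) (a b : R) : R :=
  \sum_(k < n.+1)
    qpoch q (q ^- n) k * qpoch q (a * b * q ^ (n%:Z - 1)) k * qpoch q (q ^- x) k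
    / (qpoch q a k * qpoch q (q ^- N) k * qpoch q q k) * q ^+ k.

Definition qhahn_kernel (R : realFieldType) (q : R) (N : nat) (a b c : R)
    (x y : nat) : R :=
  \sum_(z < (minn x y).+1)
    qhahn_pi q (x - z) (N - z) b c * qhahn_pi q z y a b.

Definition qhahn_kappa (R : realFieldType) (q a b c : R) (n : nat) : R :=
  \sum_(k < n.+1)
    qpoch q (q ^- n) k * qpoch q (a * b * c * q ^ (n%:Z - 1)) k * qpoch q b k
    / (qpoch q (a * b) k * qpoch q (b * c) k * qpoch q q k) * q ^+ k.

(* Main.v *)
Require Import Defs.
From mathcomp Require Import all_boot all_order all_algebra.
From mathcomp Require Import ring lra.

Set Implicit Arguments.
Unset Strict Implicit.
Unset Printing Implicit Defensive.

Import Order.TTheory GRing.Theory Num.Theory.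
Local Open Scope ring_scope.

(** The joint weight K(x,y) pi(y,N,ab,c) equals
    sum_z pi(z,N,a,bc) pi(x-z,N-z,b,c) pi(y-z,N-z,b,c), which is visibly
    symmetric: K is the composition of the averaging operator
    A f(z) = sum_y pi(y-z,N-z,b,c) f(y) with its adjoint
    A' g(x) = sum_z pi(z,x,a,b) g(z).  Averaging (q^-z;q)_k against
    pi(.,x,a,b) multiplies it by (a;q)_k/(ab;q)_k, so A' sends the q-Hahn
    polynomial with parameters (a,bc) to the one with parameters (ab,c).
    For A, one rewrites the q-Hahn polynomials in the basis
    q^((N-y)k) (q^-(N-y);q)_k by a terminating 3phi2 transformation; A is
    diagonal in this basis, and the quotient of the prefactors is the
    eigenvalue.  The same 3phi2 transformation, followed by q-Vandermonde,
    evaluates the balanced sum kappa. *)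

(** * Shifted factorials *)

(* Homogeneous form of the q-shifted factorial: [qdiff q 1 a n] is
   convertible to [qpoch q a n]. *)
Definition qdiff (R : realFieldType) (q x y : R) (n : nat) : R :=
  \prod_(i < n) (x - y * q ^+ i).

Lemma qdiff0 (R : realFieldType) (q x y : R) : qdiff q x y 0 = 1.
Proof. by rewrite /qdiff big_ord0. Qed.

Lemma qdiffSr (R : realFieldType) (q x y : R) n :
  qdiff q x y n.+1 = qdiff q x y n * (x - y * q ^+ n).
Proof. by rewrite /qdiff big_ord_recr. Qed.

Lemma qdiffSl (R : realFieldType) (q x y : R) n :
  qdiff q x y n.+1 = (x - y) * qdiff q x (y * q) n.
Proof.
rewrite /qdiff big_ord_recl expr0 mulr1; congr (_ * _).
by apply: eq_bigr => i _; rewrite exprS mulrA.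
Qed.

Lemma qdiffD (R : realFieldType) (q x y : R) m n :
  qdiff q x y (m + n) = qdiff q x y m * qdiff q x (y * q ^+ m) n.
Proof.
elim: n => [|n IHn]; first by rewrite addn0 qdiff0 mulr1.
by rewrite addnS !qdiffSr IHn -!mulrA exprD.
Qed.

Lemma qdiffZ (R : realFieldType) (q t x y : R) n :
  qdiff q (t * x) (t * y) n = t ^+ n * qdiff q x y n.
Proof.
elim: n => [|n IHn]; first by rewrite !qdiff0 mulr1.
by rewrite !qdiffSr IHn exprS; ring.
Qed.

Lemma qpoch0 (R : realFieldType) (q a : R) : qpoch q a 0 = 1.
Proof. exact: qdiff0. Qed.

Lemma qpochSr (R : realFieldType) (q a : R) n :
  qpoch q a n.+1 = qpoch q a n * (1 - a * q ^+ n).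
Proof. exact: qdiffSr. Qed.

Lemma qpochSl (R : realFieldType) (q a : R) n :
  qpoch q a n.+1 = (1 - a) * qpoch q (a * q) n.
Proof. exact: qdiffSl. Qed.

Lemma qpochD (R : realFieldType) (q a : R) m n :
  qpoch q a (m + n) = qpoch q a m * qpoch q (a * q ^+ m) n.
Proof. exact: qdiffD. Qed.

Lemma qpoch_gt0 (R : realFieldType) (q a : R) n :
  0 < q -> q < 1 -> a < 1 -> 0 < qpoch q a n.
Proof.
move=> q0 q1 a1; apply: prodr_gt0 => i _; rewrite subr_gt0.
have qi0 : 0 < q ^+ i by rewrite exprn_gt0.
have qi1 : q ^+ i <= 1 by rewrite exprn_ile1 ?ltW.
nra.
Qed.

Lemma qpoch_neq0 (R : realFieldType) (q a : R) n :
  0 < q -> q < 1 -> a < 1 -> qpoch q a n != 0.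
Proof. by move=> q0 q1 a1; rewrite gt_eqF ?qpoch_gt0. Qed.

Lemma qpoch_negpow_neq0 (R : realFieldType) (q : R) n k :
  0 < q -> q < 1 -> (k <= n)%N -> qpoch q (q ^- n) k != 0.
Proof.
move=> q0 q1 le_kn; apply/prodf_neq0 => i _; rewrite subr_eq0 eq_sym.
have lt_in : (i < n)%N by apply: leq_trans le_kn.
have -> : q ^- n * q ^+ i = (q ^+ (n - i))^-1.
  rewrite -[in q ^- n](subnK (ltnW lt_in)) exprD invfM -mulrA mulVf ?mulr1 //.
  by rewrite expf_neq0 ?gt_eqF.
rewrite invr_eq1 lt_eqF // exprn_ilt1 ?ltW //.
by rewrite subn_eq0 -ltnNge.
Qed.

(** * Gaussian binomial coefficients *)

(** The q-Pascal recursion avoids division and gives 0 for k > n, so that ranges of summation can be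
    extended freely. The quotient of q-factorials is recovered in [qbin_qpoch]. *)
Fixpoint qbin (R : realFieldType) (q : R) (n k : nat) : R :=
  match n, k with
  | _, 0 => 1
  | 0, _.+1 => 0
  | n'.+1, k'.+1 => qbin q n' k' + q ^+ k * qbin q n' k
  end.

Lemma qbin0 (R : realFieldType) (q : R) n : qbin q n 0 = 1.
Proof. by case: n. Qed.

Lemma qbinS (R : realFieldType) (q : R) n k :
  qbin q n.+1 k.+1 = qbin q n k + q ^+ k.+1 * qbin q n k.+1.
Proof. by []. Qed.

Lemma qbin_small (R : realFieldType) (q : R) n k : (n < k)%N -> qbin q n k = 0.
Proof.
elim: n k => [|n IHn] [|k] // lt_nk.
by rewrite qbinS !IHn ?mulr0 ?addr0 // ltnW.
Qed.

(** Pascal's rule under a sum. It reduces the induction step of each q-Vandermonde identity below to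
    a comparison of single terms. *)
Lemma sum_qbinS (R : realFieldType) (q : R) n (F : nat -> R) :
  \sum_(k < n.+2) qbin q n.+1 k * F k
  = \sum_(k < n.+1) qbin q n k * (q ^+ k * F k + F k.+1).
Proof.
rewrite big_ord_recl /= mul1r.
under eq_bigr => k _ do rewrite mulrDl.
under [RHS]eq_bigr => k _ do rewrite mulrDr.
rewrite !big_split /= [RHS]addrC addrCA; congr (_ + _).
rewrite big_ord_recr /= qbin_small // mulr0 mul0r addr0.
rewrite [RHS]big_ord_recl /= qbin0 expr0 !mul1r; congr (_ + _).
by apply: eq_bigr => k _; rewrite mulrA [qbin _ _ _ * _]mulrC.
Qed.

Lemma qbin_mulS (R : realFieldType) (q : R) n k :
  qbin q n.+1 k.+1 * (1 - q ^+ k.+1) = (1 - q ^+ n.+1) * qbin q n k.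
Proof.
elim: n k => [|n IHn] [|k]; rewrite qbinS.
- by rewrite /=; ring.
- by rewrite /=; ring.
- by rewrite mulrDl -mulrA (IHn 0) !qbin0 !exprS; ring.
- have vE : q ^+ k.+1 * qbin q n k.+1 = qbin q n.+1 k.+1 - qbin q n k.
    by rewrite qbinS addrC addKr.
  rewrite mulrDl -mulrA (IHn k.+1) mulrCA exprS -[q * _ * _]mulrA vE.
  by rewrite mulrCA [_ * (qbin _ _ _ - _)]mulrBr -(IHn k) !exprS; ring.
Qed.

Lemma qbin_qpoch (R : realFieldType) (q : R) m k :
  qbin q (m + k) k * (qpoch q q k * qpoch q q m) = qpoch q q (m + k).
Proof.
elim: k => [|k IHk]; first by rewrite addn0 qbin0 qpoch0 !mul1r.
rewrite addnS !qpochSr -!exprS -IHk.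
transitivity (qbin q (m + k).+1 k.+1 * (1 - q ^+ k.+1)
  * (qpoch q q k * qpoch q q m)); first by ring.
by rewrite qbin_mulS; ring.
Qed.

(** * Signs, and factorials with base q^-n *)

(* The signs and powers produced by reversing q-shifted factorials:
   [qsign q n] is (-1)^n q^(n(n-1)/2). *)
Definition qsign (R : realFieldType) (q : R) (n : nat) : R :=
  \prod_(i < n) - q ^+ i.

Lemma qsign0 (R : realFieldType) (q : R) : qsign q 0 = 1.
Proof. by rewrite /qsign big_ord0. Qed.

Lemma qsignS (R : realFieldType) (q : R) n :
  qsign q n.+1 = - q ^+ n * qsign q n.
Proof. by rewrite /qsign big_ord_recr mulrC. Qed.

Lemma qsignD (R : realFieldType) (q : R) m n :
  qsign q (m + n) = qsign q m * qsign q n * q ^+ (m * n).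
Proof.
elim: n => [|n IHn]; first by rewrite addn0 muln0 qsign0 !mulr1.
by rewrite addnS !qsignS IHn mulnS !exprD; ring.
Qed.

Lemma qsign_sqr (R : realFieldType) (q : R) n :
  qsign q n ^+ 2 * q ^+ n = q ^+ (n * n).
Proof.
elim: n => [|n IHn]; first by rewrite qsign0 expr1n mulr1.
rewrite qsignS mulSn mulnS !exprD -IHn !exprS; ring.
Qed.

Lemma qsign_neq0 (R : realFieldType) (q : R) n : q != 0 -> qsign q n != 0.
Proof. by move=> q0; apply/prodf_neq0 => i _; rewrite oppr_eq0 expf_neq0. Qed.

(** Peeling off the first factor 1 - q^-(n+1) lowers n and k together, which matches the absorption
    rule [qbin_mulS]. The power q^(nk) clears the negative exponents. *)
Lemma qpoch_negpow (R : realFieldType) (q : R) n k : q != 0 ->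
  qpoch q (q ^- n) k * q ^+ (n * k) = qsign q k * qbin q n k * qpoch q q k.
Proof.
move=> q0; elim: n k => [|n IHn] [|k].
- by rewrite !qpoch0 qsign0 /= !mulr1.
- by rewrite qpochSl expr0 invr1 /= subrr !(mul0r, mulr0).
- by rewrite !qpoch0 qsign0 muln0 /= !mulr1.
have q1 : q ^- n.+1 * q = q ^- n.
  by rewrite exprSr invfM -mulrA mulVf // mulr1.
rewrite qpochSl q1 qpochSr -exprS qsignS.
have -> : q ^+ (n.+1 * k.+1) = q ^+ n.+1 * q ^+ k * q ^+ (n * k).
  by rewrite -!exprD mulSn mulnS addnA [(k.+1 + n)%N]addnC addnS addSn.
transitivity ((q ^+ n.+1 - 1) * q ^+ k * (qpoch q (q ^- n) k * q ^+ (n * k))).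
  have : q ^+ n.+1 * q ^- n.+1 = 1 by rewrite mulfV ?expf_neq0.
  set u := q ^- n.+1; move: u => u uE.
  by rewrite -{2}uE; ring.
rewrite IHn.
transitivity (- q ^+ k * qsign q k * (qbin q n.+1 k.+1 * (1 - q ^+ k.+1))
   * qpoch q q k); last by ring.
by rewrite qbin_mulS; ring.
Qed.

(** * Three forms of q-Vandermonde *)

(** The induction step is x - z q^n = (x - y q^k) + q^k (y - z q^(n-k)). *)
Lemma qdiff_vandermonde (R : realFieldType) (q x y z : R) n :
  qdiff q x z n
  = \sum_(k < n.+1) qbin q n k * (qdiff q x y k * qdiff q y z (n - k)).
Proof.
elim: n => [|n IHn]; first by rewrite big_ord1 !qdiff0 /= !mulr1.
rewrite (sum_qbinS _ _ (fun k => qdiff q x y k * qdiff q y z (n.+1 - k))).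
rewrite qdiffSr IHn mulr_suml; apply: eq_bigr => k _.
have le_kn : (k <= n)%N by rewrite -ltnS.
rewrite subSn // subSS !qdiffSr.
have -> : q ^+ n = q ^+ k * q ^+ (n - k) by rewrite -exprD subnKC.
ring.
Qed.

(** Here the step is x - y = (x - z q^k) - (y - z q^k). Division by [qdiff q x z n] leaves
    coefficients that depend on n only through [qbin q n k], which is what [sum_phi32] exploits. *)
Lemma qdiff_vandermonde_shift (R : realFieldType) (q x y z : R) n :
  qdiff q x y n
  = \sum_(k < n.+1) qbin q n k
      * (qsign q k * qdiff q y z k * qdiff q x (z * q ^+ k) (n - k)).
Proof.
elim: n x y z => [|n IHn] x y z; first by rewrite big_ord1 !qdiff0 qsign0 /= !mulr1.
rewrite (sum_qbinS _ _ (fun k => qsign q k * qdiff q y z k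
  * qdiff q x (z * q ^+ k) (n.+1 - k))).
rewrite qdiffSl (IHn _ _ (z * q)) mulr_sumr; apply: eq_bigr => k _.
have le_kn : (k <= n)%N by rewrite -ltnS.
rewrite subSn // subSS qdiffSl qdiffSr qsignS.
rewrite [y * q]mulrC [z * q]mulrC qdiffZ.
have -> : q * z * q ^+ k = z * q ^+ k * q by rewrite -mulrA mulrC.
have -> : z * q ^+ k.+1 = z * q ^+ k * q by rewrite exprSr mulrA.
ring.
Qed.

Lemma qpoch_vandermonde_rev (R : realFieldType) (q x y : R) n :
  qsign q n * qdiff q x y n
  = \sum_(k < n.+1) qbin q n k
      * (qsign q (n - k) * qpoch q x k * qpoch q (y * q ^+ k) (n - k)).
Proof.
elim: n x y => [|n IHn] x y; first by rewrite big_ord1 !qpoch0 qdiff0 qsign0 /= !mulr1.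
rewrite (sum_qbinS _ _ (fun k => qsign q (n.+1 - k) * qpoch q x k
  * qpoch q (y * q ^+ k) (n.+1 - k))).
(* Uses x - y q^n = (1 - y q^n) - (1 - x): one part is the last factor of a term, the other the
   first factor of (x;q)_(k+1). The induction hypothesis therefore serves at (x,y) and at
   (xq,yq). *)
transitivity (- q ^+ n * (1 - y * q ^+ n) * (qsign q n * qdiff q x y n)
  + (1 - x) * (qsign q n * qdiff q (x * q) (y * q) n)).
  rewrite qsignS qdiffSr [x * q]mulrC [y * q]mulrC qdiffZ; ring.
rewrite !IHn !mulr_sumr -big_split /=; apply: eq_bigr => k _.
have le_kn : (k <= n)%N by rewrite -ltnS.
rewrite subSn // subSS qsignS qpochSr qpochSl.
have -> : q ^+ n = q ^+ k * q ^+ (n - k) by rewrite -exprD subnKC.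
have -> : y * q * q ^+ k = y * q ^+ k.+1 by rewrite exprS mulrA.
ring.
Qed.

Lemma sum_shift (R : realFieldType) n k (F : nat -> R) :
    (k <= n)%N -> (forall j, (j < k)%N -> F j = 0) ->
  \sum_(j < n.+1) F j = \sum_(i < (n - k).+1) F (k + i)%N.
Proof.
move=> le_kn F0; rewrite -subSn // -(big_mkord xpredT F).
rewrite -(big_mkord xpredT (fun i => F (k + i)%N)).
rewrite (big_cat_nat (n := k)) //=; last exact: leqW.
rewrite big_nat_cond big1 ?add0r => [|j /andP[/andP[_ /F0]]] //.
by rewrite -{1}[k]add0n big_addn; apply: eq_bigr => i _; rewrite addnC.
Qed.

(** * The q-Hahn measure *)

Lemma qhahn_pi_qbin (R : realFieldType) (q : R) x M a b :
    0 < q -> q < 1 -> (x <= M)%N ->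
  qhahn_pi q x M a b
  = qbin q M x * (qpoch q a x * qpoch q b (M - x) * a ^+ (M - x)
                  / qpoch q (a * b) M).
Proof.
move=> q0 q1 le_xM; rewrite /qhahn_pi; congr (_ * _).
rewrite -{1}(subnK le_xM) -qbin_qpoch subnK // mulfK //.
by rewrite mulf_neq0 ?qpoch_neq0.
Qed.

(** This is q-Vandermonde between 1 and ab through the intermediate point a. *)
Lemma sum_qhahn_pi (R : realFieldType) (q : R) M a b :
    0 < q -> q < 1 -> a * b < 1 ->
  \sum_(x < M.+1) qhahn_pi q x M a b = 1.
Proof.
move=> q0 q1 ab1.
have ab0 : qpoch q (a * b) M != 0 by rewrite qpoch_neq0.
apply: (mulIf ab0); rewrite mul1r mulr_suml.
rewrite {2}/qpoch -/(qdiff q 1 (a * b) M) (qdiff_vandermonde _ _ a).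
apply: eq_bigr => x _; rewrite qhahn_pi_qbin -1?ltnS //.
have -> : qdiff q a (a * b) (M - x) = a ^+ (M - x) * qpoch q b (M - x).
  by rewrite -qdiffZ mulr1.
by rewrite -!mulrA mulVf // mulr1 [a ^+ _ * _]mulrC.
Qed.

Lemma qhahn_pi_ge0 (R : realFieldType) (q : R) x M a b :
  0 < q -> q < 1 -> 0 < a -> a < 1 -> b < 1 -> 0 <= qhahn_pi q x M a b.
Proof.
move=> q0 q1 a0 a1 b1; have ab1 : a * b < 1 by nra.
have ge0 w k : w < 1 -> 0 <= qpoch q w k by move=> ?; rewrite ltW ?qpoch_gt0.
by rewrite /qhahn_pi !mulr_ge0 ?invr_ge0 ?mulr_ge0 ?exprn_ge0 ?ge0 // ltW.
Qed.

(* In the multinomial distribution of (z, y - z, N - y), the left-hand side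
   draws y first, the right-hand side draws z first. *)
Lemma qhahn_pi_nested (R : realFieldType) (q : R) z y N a b c :
    0 < q -> q < 1 -> a * b < 1 -> b * c < 1 -> (z <= y <= N)%N ->
  qhahn_pi q z y a b * qhahn_pi q y N (a * b) c
  = qhahn_pi q z N a (b * c) * qhahn_pi q (y - z) (N - z) b c.
Proof.
move=> q0 q1 ab1 bc1 /andP[le_zy le_yN]; rewrite /qhahn_pi.
have -> : (N - z - (y - z) = N - y)%N by rewrite subnBA // subnK // (leq_trans le_zy).
have -> : (N - z = (y - z) + (N - y))%N by rewrite addnC addnBA // subnK.
rewrite exprMn exprD [a * (b * c)]mulrA.
have nz w k : w < 1 -> qpoch q w k != 0 by move=> ?; rewrite qpoch_neq0.
(* The hypotheses do not exclude (abc;q)_N = 0. In that case both sides are 0, since the inverse of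
   0 is 0. *)
case: (eqVneq (qpoch q (a * b * c) N) 0) => [->|abc0]; first by rewrite invr0 !(mulr0, mul0r).
by field; rewrite abc0 !nz.
Qed.

(** * Contiguity relations and moments of the measure *)

(** The factor 1 - q^-(z+1) is the first one of (q^-(z+1);q)_(k+1). Absorbing it into the weight
    shifts a to aq, which drives the induction on k in [sum_qhahn_pi_qpoch]. *)
Lemma qhahn_pi_Sl (R : realFieldType) (q : R) z x a b :
    0 < q -> q < 1 -> a < 1 -> a * b < 1 -> (z <= x)%N ->
  qhahn_pi q z.+1 x.+1 a b * (1 - q ^- z.+1)
  = (1 - q ^- x.+1) * ((1 - a) / (1 - a * b)) * qhahn_pi q z x (a * q) b.
Proof.
move=> q0 q1 a1 ab1 le_zx.
rewrite /qhahn_pi subSS !(qpochSr q q) !(qpochSl _ a) !(qpochSl _ (a * b)).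
rewrite -!exprS [a * b * q]mulrAC exprMn.
have [d ->] : exists d, x = (z + d)%N by exists (x - z)%N; rewrite subnKC.
rewrite addKn.
have nz w k : w < 1 -> qpoch q w k != 0 by move=> ?; rewrite qpoch_neq0.
have qz k : 1 - q ^+ k.+1 != 0.
  by rewrite subr_eq0 eq_sym lt_eqF // exprn_ilt1 // ltW.
have aqb1 : a * q * b < 1 by case: (ltrP 0 (a * b)) => ?; rewrite mulrAC; nra.
have qz' := qz (z + d)%N; move: qz'; have := qz z.
rewrite !exprS exprD => qz1 qz2.
field; rewrite !nz // qz1 !expf_neq0 ?gt_eqF // subr_gt0 //.
Qed.

Lemma mulq_lt1 (R : realFieldType) (q a : R) :
  0 < q -> q < 1 -> a < 1 -> a * q < 1.
Proof. by move=> q0 q1 a1; case: (ltrP 0 a) => ?; nra. Qed.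

(** The mirror relation, absorbing a factor in M + 1 - x and shifting b to bq. *)
Lemma qhahn_pi_Sr (R : realFieldType) (q : R) x M a b :
    0 < q -> q < 1 -> b < 1 -> a * b < 1 -> (x <= M)%N ->
  qhahn_pi q x M.+1 a b * (q ^+ (M.+1 - x) - 1)
  = (q ^+ M.+1 - 1) * (a * (1 - b) / (1 - a * b)) * qhahn_pi q x M a (b * q).
Proof.
move=> q0 q1 b1 ab1 le_xM.
rewrite /qhahn_pi subSn // !(qpochSr q q) !(qpochSl _ b) !(qpochSl _ (a * b)).
rewrite [a * (b * q)]mulrA.
have [d ->] : exists d, M = (x + d)%N by exists (M - x)%N; rewrite subnKC.
rewrite addKn.
have nz w k : w < 1 -> qpoch q w k != 0 by move=> ?; rewrite qpoch_neq0.
have qz k : 1 - q ^+ k.+1 != 0.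
  by rewrite subr_eq0 eq_sym lt_eqF // exprn_ilt1 // ltW.
have abq1 : a * b * q < 1 by exact: mulq_lt1.
have := qz d; rewrite !exprS => qd.
field; rewrite !nz // qd subr_eq0 gt_eqF //.
Qed.

Lemma qpoch_expV0 (R : realFieldType) (q : R) k : qpoch q (q ^- 0) k.+1 = 0.
Proof. by rewrite qpochSl expr0 invr1 subrr mul0r. Qed.

Lemma sum_qhahn_pi_qpoch (R : realFieldType) (q : R) x k a b :
    0 < q -> q < 1 -> a < 1 -> a * b < 1 ->
  \sum_(z < x.+1) qhahn_pi q z x a b * qpoch q (q ^- z) k
  = qpoch q a k / qpoch q (a * b) k * qpoch q (q ^- x) k.
Proof.
move=> q0 q1; elim: k x a => [|k IHk] x a a1 ab1.
  under eq_bigr do rewrite qpoch0 mulr1.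
  by rewrite sum_qhahn_pi // !qpoch0 invr1 !mulr1.
have qK n : q ^- n.+1 * q = q ^- n.
  by rewrite exprSr invfM -mulrA mulVf ?mulr1 // gt_eqF.
(* The term z = 0 vanishes because (1;q)_(k+1) = 0, so every remaining index is a successor. *)
rewrite big_ord_recl qpoch_expV0 mulr0 add0r.
case: x => [|x]; first by rewrite big_ord0 qpoch_expV0 ?mul0r mulr0.
transitivity ((1 - q ^- x.+1) * ((1 - a) / (1 - a * b))
  * \sum_(z < x.+1) qhahn_pi q z x (a * q) b * qpoch q (q ^- z) k).
  rewrite mulr_sumr; apply: eq_bigr => z _.
  by rewrite qpochSl qK mulrA qhahn_pi_Sl -1?ltnS // -[LHS]mulrA.
have aqb1 : a * q * b < 1 by rewrite mulrAC mulq_lt1.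
rewrite IHk ?(mulq_lt1 q0 q1) // !qpochSl qK [a * b * q]mulrAC.
by rewrite invfM; ring.
Qed.

(** With m = M - x, the function (q^-m;q)_k q^(mk) is the product of the q^m - q^i for i < k. Its
    first factor q^m - 1 is absorbed by [qhahn_pi_Sr]. *)
Lemma sum_qhahn_pi_qpoch_rev (R : realFieldType) (q : R) M k a b :
    0 < q -> q < 1 -> b < 1 -> a * b < 1 ->
  \sum_(x < M.+1) qhahn_pi q x M a b
      * (qpoch q (q ^- (M - x)) k * q ^+ ((M - x) * k))
  = a ^+ k * qpoch q b k / qpoch q (a * b) k
    * (qpoch q (q ^- M) k * q ^+ (M * k)).
Proof.
move=> q0 q1; elim: k M b => [|k IHk] M b b1 ab1.
  under eq_bigr do rewrite qpoch0 muln0 !mulr1.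
  by rewrite sum_qhahn_pi // !qpoch0 muln0 invr1 !mulr1.
have qK n : qpoch q (q ^- n.+1) k.+1 * q ^+ (n.+1 * k.+1)
    = q ^+ k * (q ^+ n.+1 - 1) * (qpoch q (q ^- n) k * q ^+ (n * k)).
  have -> : qpoch q (q ^- n.+1) k.+1 = (1 - q ^- n.+1) * qpoch q (q ^- n) k.
    rewrite qpochSl; congr (_ * qpoch _ _ _).
    by rewrite exprSr invfM -mulrA mulVf ?mulr1 // gt_eqF.
  have -> : q ^+ (n.+1 * k.+1) = q ^+ n.+1 * q ^+ k * q ^+ (n * k).
    by rewrite -!exprD mulSn mulnS addnA [(k.+1 + n)%N]addnC addnS addSn.
  have : q ^+ n.+1 * q ^- n.+1 = 1 by rewrite mulfV // expf_neq0 // gt_eqF.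
  set u := q ^- n.+1; move: u => u uE.
  by rewrite -{2}uE; ring.
rewrite big_ord_recr /= subnn qpoch_expV0 mul0r mulr0 addr0.
case: M => [|M]; first by rewrite big_ord0 qpoch_expV0 ?mul0r mulr0.
rewrite qK; transitivity ((q ^+ M.+1 - 1) * (a * (1 - b) / (1 - a * b)) * q ^+ k
  * \sum_(x < M.+1) qhahn_pi q x M a (b * q)
      * (qpoch q (q ^- (M - x)) k * q ^+ ((M - x) * k))).
  rewrite mulr_sumr; apply: eq_bigr => x _.
  have le_xM : (x <= M)%N by rewrite -ltnS.
  have := qhahn_pi_Sr q0 q1 b1 ab1 le_xM; rewrite subSn // => pE.
  rewrite qK [LHS]mulrA [_ * (q ^+ k * _)]mulrCA pE; ring.
have abq1 : a * (b * q) < 1 by rewrite mulrA mulq_lt1.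
rewrite IHk ?(mulq_lt1 q0 q1) // !qpochSl !exprS [a * (b * q)]mulrA.
by rewrite invfM; ring.
Qed.

(** * Terminating 2phi1 and 3phi2 series *)

Lemma qpoch_neq0W (R : realFieldType) (q a : R) n k :
  (k <= n)%N -> qpoch q a n != 0 -> qpoch q a k != 0.
Proof.
by move=> le_kn; rewrite -(subnKC le_kn) qpochD mulf_eq0 negb_or => /andP[].
Qed.

Lemma sum_qbin_widen (R : realFieldType) (q : R) j n (F : nat -> R) :
    (j <= n)%N ->
  \sum_(k < j.+1) qbin q j k * F k = \sum_(k < n.+1) qbin q j k * F k.
Proof.
move=> le_jn; rewrite (big_ord_widen n.+1 (fun k => qbin q j k * F k)) //.
rewrite big_mkcond; apply: eq_bigr => k _.
by case: ltnP => // lt_jk; rewrite qbin_small // mul0r.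
Qed.

(** The q-Chu-Vandermonde sum: [qpoch_vandermonde_rev] divided by [qsign q n] and (e;q)_n. Writing
    B^n (e/B;q)_n as [qdiff q B e n] admits B = 0. *)
Lemma sum_phi21 (R : realFieldType) (q B e : R) n :
    0 < q -> q < 1 -> qpoch q e n != 0 ->
  \sum_(k < n.+1) qpoch q (q ^- n) k * qpoch q B k / (qpoch q e k * qpoch q q k)
      * q ^+ k
  = qdiff q B e n / qpoch q e n.
Proof.
move=> q0 q1 en0; have qn0 : q != 0 by rewrite gt_eqF.
apply: (mulfI (qsign_neq0 n qn0)); rewrite mulrA qpoch_vandermonde_rev.
rewrite mulr_suml mulr_sumr; apply: eq_bigr => k _.
have le_kn : (k <= n)%N by rewrite -ltnS.
move: (nat_of_ord k) le_kn => {}k le_kn.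
have := qpoch_neq0W le_kn en0; have := qpoch_negpow n k qn0.
move: en0; rewrite -(subnKC le_kn) addKn qpochD mulf_eq0 negb_or => /andP[_].
move: (n - k)%N => d {n le_kn}; rewrite qsignD.
have qk0 i : q ^+ i != 0 by rewrite expf_neq0.
rewrite mulnDl (exprD _ (k * k)) -qsign_sqr => ed0 negE ek0.
have -> : qpoch q (q ^- (k + d)) k
    = qbin q (k + d) k * qpoch q q k / (qsign q k * q ^+ k * q ^+ (k * d)).
  (* The multiplier equals q^((k+d)k) by [qsign_sqr], the power carried by [negE]. *)
  apply: (mulIf (mulf_neq0 (mulf_neq0 (expf_neq0 2 (qsign_neq0 k qn0)) (qk0 k)) (qk0 (d * k)%N))).
  rewrite negE [(d * k)%N]mulnC; field.
  by rewrite !qk0 qsign_neq0.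
by field; rewrite !qk0 ek0 ed0 qsign_neq0 // qpoch_neq0.
Qed.

(* The terminating 3phi2 transformation (III.12) of Gasper and Rahman, cleared
   of the quotients d/b and e/B so that B = 0 is allowed. *)
Lemma sum_phi32 (R : realFieldType) (q B b d e : R) n :
    0 < q -> q < 1 -> qpoch q d n != 0 -> qpoch q e n != 0 ->
  \sum_(j < n.+1) qpoch q (q ^- n) j * qpoch q B j * qpoch q b j
      / (qpoch q e j * qpoch q d j * qpoch q q j) * q ^+ j
  = \sum_(k < n.+1) qpoch q (q ^- n) k * qpoch q B k * qdiff q b d k
      / (qpoch q d k * qpoch q q k * qpoch q e n)
      * (qsign q k * q ^+ k * q ^+ (k * (n - k)) * qdiff q B e (n - k)).
Proof.
move=> q0 q1 dn0 en0.
have qn0 : q != 0 by rewrite gt_eqF.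
have qq0 i : qpoch q q i != 0 by rewrite qpoch_neq0.
pose G j := qpoch q (q ^- n) j * qpoch q B j / (qpoch q e j * qpoch q q j) * q ^+ j.
(* Expanding through d writes (b;q)_j/(d;q)_j as a sum of [qbin q j k] times coefficients free of j.
   The range of k is widened to n so that the sums can be exchanged. *)
transitivity (\sum_(j < n.+1) \sum_(k < n.+1)
    qdiff q b d k * qsign q k / qpoch q d k * (G j * qbin q j k)).
  apply: eq_bigr => j _; have le_jn : (j <= n)%N by rewrite -ltnS.
  have dj0 := qpoch_neq0W le_jn dn0; have ej0 := qpoch_neq0W le_jn en0.
  transitivity (G j / qpoch q d j * qpoch q b j).
    by rewrite /G; field; rewrite dj0 ej0 qq0.
  rewrite {2}/qpoch -/(qdiff q 1 b j) (qdiff_vandermonde_shift _ _ _ d).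
  transitivity (G j * \sum_(k < j.+1) qbin q j k
      * (qsign q k * qdiff q b d k / qpoch q d k)).
    rewrite -mulrA; congr (_ * _); rewrite mulr_sumr; apply: eq_bigr => k _.
    have le_kj : (k <= j)%N by rewrite -ltnS.
    move: dj0; rewrite -[in qpoch q d j](subnKC le_kj) qpochD -/(qpoch q _ _).
    rewrite mulf_eq0 negb_or /qpoch -!/(qdiff q 1 _ _) => /andP[dk0 dkj0].
    by field; rewrite dk0 dkj0.
  rewrite (sum_qbin_widen _ (fun k => qsign q k * qdiff q b d k / qpoch q d k) le_jn).
  by rewrite mulr_sumr; apply: eq_bigr => k _; ring.
rewrite exchange_big; apply: eq_bigr => k _.
have le_kn : (k <= n)%N by rewrite -ltnS.
have dk0 := qpoch_neq0W le_kn dn0; have ek0 := qpoch_neq0W le_kn en0.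
rewrite -mulr_sumr (sum_shift (F := fun j => G j * qbin q j k) le_kn); last first.
  by move=> j lt_jk; rewrite qbin_small // mulr0.
have ekn0 : qpoch q (e * q ^+ k) (n - k) != 0.
  by move: en0; rewrite -{1}(subnKC le_kn) qpochD mulf_eq0 negb_or => /andP[].
(* After j = k + i, the inner sum is a terminating 2phi1 with n - k, B q^k, e q^k in place of n, B,
   e. *)
transitivity (qdiff q b d k * qsign q k / qpoch q d k
  * (qpoch q (q ^- n) k * qpoch q B k / (qpoch q e k * qpoch q q k) * q ^+ k)
  * \sum_(i < (n - k).+1) qpoch q (q ^- (n - k)) i * qpoch q (B * q ^+ k) i
      / (qpoch q (e * q ^+ k) i * qpoch q q i) * q ^+ i).
  rewrite -[RHS]mulrA; congr (_ * _); rewrite mulr_sumr; apply: eq_bigr => i _.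
  have qnk : q ^- n * q ^+ k = q ^- (n - k).
    by rewrite -[in q ^- n](subnK le_kn) exprD invfM -mulrA mulVf ?mulr1 ?expf_neq0.
  have le_ink : (i <= n - k)%N by rewrite -ltnS.
  have eki0 := qpoch_neq0W le_ink ekn0.
  rewrite /G !(qpochD _ (q ^- n)) !(qpochD _ B) !(qpochD _ e) qnk exprD.
  rewrite [in qpoch q q (k + i)]addnC -qbin_qpoch [in qbin q (i + k)]addnC.
  have bin0 : qbin q (k + i) k != 0.
    by have := qq0 (i + k)%N; rewrite -qbin_qpoch mulf_eq0 negb_or addnC => /andP[].
  by field; rewrite ek0 eki0 bin0 !qq0.
rewrite sum_phi21 // [B * _]mulrC [e * _]mulrC qdiffZ.
rewrite -[in qpoch q e n](subnKC le_kn) qpochD [q ^+ k * e]mulrC -exprM.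
by field; rewrite dk0 ek0 ekn0 qq0.
Qed.

Lemma expz_predn_mul (R : realFieldType) (q : R) (n : nat) :
  q != 0 -> q ^ (n%:Z - 1) * q = q ^+ n.
Proof. by move=> q0; rewrite expfzDr // mulfVK. Qed.

(** Reverses the order of the factors: x q^(n-1) - q^i = -q^i (1 - x q^(n-1-i)). *)
Lemma qdiff_rev (R : realFieldType) (q x : R) n : q != 0 ->
  qdiff q (x * q ^ (n%:Z - 1)) 1 n = qsign q n * qpoch q x n.
Proof.
move=> q0; elim: n x => [|n IHn] x; first by rewrite qdiff0 qsign0 qpoch0 mulr1.
have -> : q ^ (n.+1%:Z - 1) = q ^+ n.
  by apply: (mulIf q0); rewrite expz_predn_mul // exprSr.
rewrite qdiffSr -{1}(expz_predn_mul n q0) [_ * q]mulrC mulrA IHn.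
by rewrite qpochSl qsignS; ring.
Qed.

(* Here [B = e c q^(n-1)], which turns the factors [qdiff q B e (n - k)] into
   quotients of (c;q)_n by (c;q)_k. *)
Lemma sum_phi32_balanced (R : realFieldType) (q b c d e : R) n :
    0 < q -> q < 1 ->
    qpoch q c n != 0 -> qpoch q d n != 0 -> qpoch q e n != 0 ->
  \sum_(j < n.+1) qpoch q (q ^- n) j * qpoch q (e * c * q ^ (n%:Z - 1)) j
      * qpoch q b j / (qpoch q e j * qpoch q d j * qpoch q q j) * q ^+ j
  = qsign q n * qpoch q c n / qpoch q e n
    * \sum_(k < n.+1)
        qpoch q (q ^- n) k * qpoch q (e * c * q ^ (n%:Z - 1)) k * qdiff q b d k
        / (qpoch q d k * qpoch q c k * qpoch q q k)
        * q ^+ k * e ^+ (n - k).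
Proof.
move=> q0 q1 cn0 dn0 en0; rewrite sum_phi32 // mulr_sumr.
have qn0 : q != 0 by rewrite gt_eqF.
apply: eq_bigr => k _; have le_kn : (k <= n)%N by rewrite -ltnS.
have -> : qdiff q (e * c * q ^ (n%:Z - 1)) e (n - k)
    = e ^+ (n - k) * (qsign q (n - k) * qpoch q (c * q ^+ k) (n - k)).
  rewrite -qdiff_rev // -qdiffZ mulr1 -!mulrA; congr (qdiff q (e * (c * _)) e _).
  apply: (mulIf qn0); rewrite -mulrA !expz_predn_mul //.
  by rewrite -exprD subnKC.
have ck0 := qpoch_neq0W le_kn cn0; have dk0 := qpoch_neq0W le_kn dn0.
rewrite -[in qsign q n](subnKC le_kn) -[in qpoch q c n](subnKC le_kn).
rewrite qsignD qpochD.
by field; rewrite ck0 dk0 en0 qpoch_neq0.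
Qed.

(** * Closed form of the eigenvalue *)

(** In the balanced transformation with e = ab and d = bc, the factor [qdiff q b (b * c) k] is b^k
    (c;q)_k and cancels a lower parameter. What remains is a q-Vandermonde sum. *)
Lemma qhahn_kappaE (R : realFieldType) (q a b c : R) n :
    0 < q -> q < 1 -> a != 0 ->
    qpoch q c n != 0 -> qpoch q (b * c) n != 0 -> qpoch q (a * b) n != 0 ->
  qhahn_kappa q a b c n
  = b ^+ n * qpoch q a n * qpoch q c n
    / (qpoch q (a * b) n * qpoch q (b * c) n).
Proof.
move=> q0 q1 a0 cn0 bcn0 abn0; rewrite /qhahn_kappa sum_phi32_balanced //.
have qn0 : q != 0 by rewrite gt_eqF.
set u := q ^ (n%:Z - 1).
have uq : u * q = q ^+ n by exact: expz_predn_mul.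
have u0 : u != 0 by have := expf_neq0 n qn0; rewrite -uq mulf_eq0 negb_or => /andP[].
have s0 : qsign q n != 0 by exact: qsign_neq0.
(* Both sides are q^(n(n-1)); this later cancels the two signs against u^n. *)
have un : u ^+ n = qsign q n ^+ 2.
  apply: (mulIf (expf_neq0 n qn0)).
  by rewrite qsign_sqr -exprMn uq exprM.
transitivity (qsign q n * qpoch q c n / qpoch q (a * b) n
  * (b ^+ n * a ^+ n / qpoch q (b * c) n * qpoch q (a * u)^-1 n)).
  (* Read backwards, the sum is the expansion of ((au)^-1;q)_n through bc. *)
  rewrite (qdiff_vandermonde_shift _ _ _ (b * c) _ : qpoch q (a * u)^-1 n = _).
  congr (_ * _); rewrite mulr_sumr; apply: eq_bigr => k _.
  have le_kn : (k <= n)%N by rewrite -ltnS.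
  move: (nat_of_ord k) le_kn => {}k le_kn.
  have ck0 := qpoch_neq0W le_kn cn0; have bck0 := qpoch_neq0W le_kn bcn0.
  have -> : qdiff q b (b * c) k = b ^+ k * qpoch q c k by rewrite -qdiffZ mulr1.
  have -> : qpoch q (a * b * c * u) k = (a * u) ^+ k * qdiff q (a * u)^-1 (b * c) k.
    rewrite -qdiffZ mulfV ?mulf_neq0 //; congr qdiff; ring.
  have -> : qpoch q (q ^- n) k
      = qsign q k * qbin q n k * qpoch q q k / (u ^+ k * q ^+ k).
    rewrite -qpoch_negpow // -exprMn uq -exprM mulfK // expf_neq0 //.
  have bcE := qpochD q (b * c) k (n - k); rewrite subnKC // in bcE.
  have bcnk0 : qpoch q (b * c * q ^+ k) (n - k) != 0.
    by move: bcn0; rewrite bcE mulf_eq0 negb_or => /andP[].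
  rewrite bcE -/(qpoch q _ _) -/(qdiff q 1 _ _).
  have -> : b ^+ n = b ^+ k * b ^+ (n - k) by rewrite -exprD subnKC.
  have -> : a ^+ n = a ^+ k * a ^+ (n - k) by rewrite -exprD subnKC.
  rewrite !exprMn.
  rewrite -[qdiff q 1 _ _]/(qpoch q (b * c * q ^+ k) (n - k)).
  field; rewrite ck0 bck0 bcnk0 !expf_neq0 // qpoch_neq0 //.
have -> : qpoch q (a * u)^-1 n = qsign q n * qpoch q a n / (a * u) ^+ n.
  have au0 : a * u != 0 by rewrite mulf_neq0.
  apply: (mulIf (expf_neq0 n au0)); rewrite divfK ?expf_neq0 // mulrC.
  rewrite -[qpoch q (a * u)^-1 n]/(qdiff q 1 (a * u)^-1 n) -qdiffZ.
  by rewrite mulr1 mulfV // qdiff_rev.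
rewrite exprMn un; field.
by rewrite abn0 bcn0 s0 expf_neq0.
Qed.

(** * Averages of q-Hahn polynomials *)

(** The transformation with upper parameter q^-y and d = q^-N: [qdiff q (q ^- y) (q ^- N) k] is
    (q^-(N-y);q)_k up to a power of q. This is the basis of [sum_qhahn_pi_qpoch_rev]. *)
Lemma qhahn_poly_rev (R : realFieldType) (q e c : R) N n y :
    0 < q -> q < 1 -> e < 1 -> c < 1 -> (n <= N)%N -> (y <= N)%N ->
  qhahn_poly q N n y e c
  = qsign q n * qpoch q c n / qpoch q e n
    * \sum_(k < n.+1)
        qpoch q (q ^- n) k * qpoch q (e * c * q ^ (n%:Z - 1)) k
        / (qpoch q (q ^- N) k * qpoch q c k * qpoch q q k)
        * (q ^+ k / q ^+ (N * k)) * e ^+ (n - k)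
        * (qpoch q (q ^- (N - y)) k * q ^+ ((N - y) * k)).
Proof.
move=> q0 q1 e1 c1 le_nN le_yN; have qn0 : q != 0 by rewrite gt_eqF.
rewrite /qhahn_poly sum_phi32_balanced ?qpoch_negpow_neq0 ?qpoch_neq0 //.
congr (_ * _); apply: eq_bigr => k _.
have -> : qdiff q (q ^- y) (q ^- N) k
    = qpoch q (q ^- (N - y)) k * (q ^+ ((N - y) * k) / q ^+ (N * k)).
  rewrite mulrC !exprM -expr_div_n -qdiffZ mulr1.
  have -> : q ^+ (N - y) / q ^+ N = q ^- y.
    by rewrite -[in q ^+ N](subnK le_yN) exprD invfM mulVKf ?expf_neq0.
  congr qdiff; rewrite -[in q ^- N](subnK le_yN) exprD; field.
  by rewrite !expf_neq0.
by ring.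
Qed.

(** Termwise: the moment factor replaces (a;q)_k by (ab;q)_k below, while the product abc above is
    common to both parameter pairs. *)
Lemma sum_qhahn_pi_poly (R : realFieldType) (q a b c : R) N n x :
    0 < q -> q < 1 -> a < 1 -> a * b < 1 ->
  \sum_(z < x.+1) qhahn_pi q z x a b * qhahn_poly q N n z a (b * c)
  = qhahn_poly q N n x (a * b) c.
Proof.
move=> q0 q1 a1 ab1; rewrite /qhahn_poly.
under eq_bigr do rewrite mulr_sumr.
rewrite exchange_big; apply: eq_bigr => k _ /=.
transitivity (qpoch q (q ^- n) k * qpoch q (a * b * c * q ^ (n%:Z - 1)) k
  / (qpoch q a k * qpoch q (q ^- N) k * qpoch q q k) * q ^+ k
  * \sum_(z < x.+1) qhahn_pi q z x a b * qpoch q (q ^- z) k).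
  rewrite mulr_sumr; apply: eq_bigr => z _; rewrite [a * (b * c)]mulrA; ring.
rewrite sum_qhahn_pi_qpoch //.
have a0 : qpoch q a k != 0 by rewrite qpoch_neq0.
by rewrite !invfM -{2}[qpoch q (q ^- x) k]mul1r -(mulVf a0); ring.
Qed.

(** Averaging multiplies term k by b^k (c;q)_k/(bc;q)_k. Since (ab)^(n-k) b^k = a^(n-k) b^n, the
    only change outside the new parameters is a factor independent of k. *)
Lemma sum_qhahn_pi_poly_rev (R : realFieldType) (q a b c : R) N n z :
    0 < q -> q < 1 -> a < 1 -> c < 1 -> a * b < 1 -> b * c < 1 ->
    (n <= N)%N -> (z <= N)%N ->
  \sum_(w < (N - z).+1)
    qhahn_pi q w (N - z) b c * qhahn_poly q N n (z + w) (a * b) c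
  = b ^+ n * qpoch q a n * qpoch q c n
      / (qpoch q (a * b) n * qpoch q (b * c) n)
    * qhahn_poly q N n z a (b * c).
Proof.
move=> q0 q1 a1 c1 ab1 bc1 le_nN le_zN.
have nz w i : w < 1 -> qpoch q w i != 0 by move=> ?; rewrite qpoch_neq0.
rewrite (qhahn_poly_rev q0 q1 a1 bc1) //.
pose C k := qpoch q (q ^- n) k * qpoch q (a * b * c * q ^ (n%:Z - 1)) k
        / (qpoch q (q ^- N) k * qpoch q c k * qpoch q q k)
        * (q ^+ k / q ^+ (N * k)) * (a * b) ^+ (n - k).
transitivity (qsign q n * qpoch q c n / qpoch q (a * b) n
  * \sum_(k < n.+1) C k * \sum_(w < (N - z).+1) qhahn_pi q w (N - z) b c
      * (qpoch q (q ^- (N - z - w)) k * q ^+ ((N - z - w) * k))).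
  under [in RHS]eq_bigr do rewrite mulr_sumr.
  rewrite exchange_big mulr_sumr; apply: eq_bigr => w _.
  have le_w : (z + w <= N)%N by rewrite -leq_subRL // -ltnS.
  rewrite qhahn_poly_rev // subnDA mulrCA; congr (_ * _).
  by rewrite mulr_sumr; apply: eq_bigr => k _; rewrite /C; ring.
rewrite !mulr_sumr; apply: eq_bigr => k _.
have le_kn : (k <= n)%N by rewrite -ltnS.
rewrite sum_qhahn_pi_qpoch_rev // /C [a * (b * c)]mulrA exprMn.
have -> : b ^+ n = b ^+ k * b ^+ (n - k) by rewrite -exprD subnKC.
have qN0 : qpoch q (q ^- N) k != 0.
  by rewrite qpoch_negpow_neq0 // (leq_trans le_kn).
by field; rewrite qN0 !nz // expf_neq0 // gt_eqF.
Qed.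

(** * The kernel: factorization, symmetry and spectrum *)

Lemma sum_qhahn_kernel (R : realFieldType) (q a b c : R) N y (f : nat -> R) :
    (y <= N)%N ->
  \sum_(x < N.+1) qhahn_kernel q N a b c x y * f x
  = \sum_(z < y.+1) qhahn_pi q z y a b
      * \sum_(w < (N - z).+1) qhahn_pi q w (N - z) b c * f (z + w)%N.
Proof.
move=> le_yN.
(* Extension by 0 is needed because x - z is truncated for x < z; it gives a range of z that does
   not depend on x. *)
pose G z x := if (z <= x)%N then qhahn_pi q (x - z) (N - z) b c else 0.
transitivity (\sum_(x < N.+1) \sum_(z < y.+1) qhahn_pi q z y a b * (G z x * f x)).
  apply: eq_bigr => x _; rewrite /qhahn_kernel.
  rewrite (big_ord_widen y.+1 (fun z => qhahn_pi q (x - z) (N - z) b c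
    * qhahn_pi q z y a b)) ?ltnS ?geq_minr //.
  rewrite big_mkcond mulr_suml; apply: eq_bigr => z _.
  rewrite ltnS leq_min -[(z <= y)%N]ltnS ltn_ord andbT /G.
  by case: ifP => _; ring.
rewrite exchange_big; apply: eq_bigr => z _.
have le_zN : (z <= N)%N by rewrite (leq_trans _ le_yN) // -ltnS.
rewrite -mulr_sumr; congr (_ * _).
rewrite (sum_shift (F := fun x => G z x * f x) le_zN) => [|x lt_xz].
  by apply: eq_bigr => w _; rewrite /G leq_addr addKn.
by rewrite /G leqNgt lt_xz mul0r.
Qed.

Lemma qhahn_kernel_sym (R : realFieldType) (q a b c : R) N x y :
    0 < q -> q < 1 -> a * b < 1 -> b * c < 1 -> (x <= N)%N -> (y <= N)%N ->
  qhahn_kernel q N a b c x y * qhahn_pi q y N (a * b) c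
  = qhahn_kernel q N a b c y x * qhahn_pi q x N (a * b) c.
Proof.
move=> q0 q1 ab1 bc1 le_xN le_yN.
rewrite /qhahn_kernel minnC !mulr_suml; apply: eq_bigr => z _.
have := ltn_ord z; rewrite ltnS leq_min => /andP[le_zy le_zx].
by rewrite -[LHS]mulrA -[RHS]mulrA !qhahn_pi_nested ?le_zy ?le_zx // mulrCA [RHS]mulrCA [X in _ * X]mulrC.
Qed.

Theorem mainTheorem6 (R : realFieldType) (q : R) (N : nat) (a b c : R)
    (hq0 : 0 < q) (hq1 : q < 1) (hN : (1 <= N)%N)
    (ha0 : 0 < a) (ha1 : a < 1) (hb0 : 0 < b) (hb1 : b < 1) (hc1 : c < 1) :
  [/\ forall x y : 'I_N.+1, 0 <= qhahn_kernel q N a b c x y,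
      forall y : 'I_N.+1, \sum_(x < N.+1) qhahn_kernel q N a b c x y = 1,
      forall x y : 'I_N.+1,
        qhahn_kernel q N a b c x y * qhahn_pi q y N (a * b) c
        = qhahn_kernel q N a b c y x * qhahn_pi q x N (a * b) c,
      forall n x : 'I_N.+1,
        \sum_(y < N.+1) qhahn_kernel q N a b c x y * qhahn_pi q y N (a * b) c
                        * qhahn_poly q N n y (a * b) c
        = qhahn_kappa q a b c n * qhahn_pi q x N (a * b) c
          * qhahn_poly q N n x (a * b) c
    & forall n : 'I_N.+1,
        qhahn_kappa q a b c n
        = b ^+ n * qpoch q a n * qpoch q c n
          / (qpoch q (a * b) n * qpoch q (b * c) n)].
Proof.
have ab1 : a * b < 1 by nra.
have bc1 : b * c < 1 by nra.
have le_ord (i : 'I_N.+1) : (i <= N)%N by rewrite -ltnS.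
have kappaE n : qhahn_kappa q a b c n = b ^+ n * qpoch q a n * qpoch q c n
    / (qpoch q (a * b) n * qpoch q (b * c) n).
  by rewrite qhahn_kappaE ?qpoch_neq0 // gt_eqF.
split=> //.
- move=> x y; apply: sumr_ge0 => z _.
  by rewrite mulr_ge0 ?qhahn_pi_ge0.
- move=> y; transitivity (\sum_(x < N.+1) qhahn_kernel q N a b c x y * 1).
    by apply: eq_bigr => x _; rewrite mulr1.
  rewrite (sum_qhahn_kernel _ _ _ _ (fun=> 1)) //.
  rewrite -[RHS](sum_qhahn_pi y hq0 hq1 ab1); apply: eq_bigr => z _.
  by under eq_bigr do rewrite mulr1; rewrite sum_qhahn_pi // mulr1.
- by move=> x y; rewrite qhahn_kernel_sym.
- move=> n x.
  (* Symmetry moves the summation to the first argument of the kernel, where [sum_qhahn_kernel]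
     applies. *)
  transitivity (qhahn_pi q x N (a * b) c
      * \sum_(y < N.+1) qhahn_kernel q N a b c y x
          * qhahn_poly q N n y (a * b) c).
    rewrite mulr_sumr; apply: eq_bigr => y _.
    by rewrite qhahn_kernel_sym // mulrA [_ * qhahn_pi _ _ _ _ _]mulrC.
  rewrite (sum_qhahn_kernel _ _ _ _ (fun y => qhahn_poly q N n y (a * b) c)) //.
  (* The polynomial on the right is written as an average over z too, so both sides agree term by
     term through [sum_qhahn_pi_poly_rev]. *)
  rewrite -(sum_qhahn_pi_poly c N n x hq0 hq1 ha1 ab1) kappaE.
  rewrite [RHS]mulrAC mulrC; congr (_ * _); rewrite mulr_sumr.
  apply: eq_bigr => z _.
  have le_zN : (z <= N)%N by rewrite (leq_trans _ (le_ord x)) // -ltnS.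
  by rewrite sum_qhahn_pi_poly_rev //; ring.
Qed.
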